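(* Let $M$ be a positroid of rank $d$ on $[n]$ and let $\Gamma_M$ be its matroid polytope. Then the face poset of $\Gamma_M$ (all faces, including the empty face, ordered by inclusion) is isomorphic to an induced subposet of $NC_n^d \cup \{\widehat{0}\}$; that is, there is an injective map $\phi$ from the set of faces of $\Gamma_M$ to $NC_n^d\cup\{\widehat 0\}$ such that $F\subseteq G$ if and only if $\phi(F)\leq\phi(G)$.
   Context: A matroid $M$ on $[n]$ is a positroid if there is a real $d\times n$ matrix of rank $d$ with all maximal minors nonnegative whose column matroid is $M$ (column $i$ corresponding to element $i$). The matroid polytope is $\Gamma_M=\mathrm{conv}\{e_B : B \text{ a basis of } M\}\subset\mathbb{R}^n$, where $e_B=\sum_{i\in B}e_i$. A partition of $[n]$ into nonempty blocks is non-crossing if there are no $a,b,c,d$ in cyclic order with $a,c$ in one block and $b,d$ in a different block. A weighted non-crossing partition of $[n]$ is a non-crossing partition $\{S_1,\dots,S_t\}$ together with integer weights $w(S_i)$ with $0\leq w(S_i)\leq |S_i|$; its weight is $\sum_i w(S_i)$. $NC_n^d$ is the set of weighted non-crossing partitions of $[n]$ of weight $d$, partially ordered by the reflexive-transitive closure of the following cover relation: $S^w \lessdot T^v$ if $T=\{T_1,\dots,T_t\}$ and $S=\{T_1,\dots,T_{h-1},A,T_h - A,T_{h+1},\dots,T_t\}$ for some index $h$ and some $\emptyset\subsetneq A\subsetneq T_h$, with $v(T_h)=w(A)+w(T_h-A)$ and $v(T_j)=w(T_j)$ for $j\neq h$. $NC_n^d\cup\{\widehat 0\}$ is this poset with a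 new minimum element $\widehat 0$ adjoined. *)

(* Defs.v *)
From mathcomp Require Import all_boot all_order all_algebra.
From mathcomp Require Import all_classical all_reals.

Set Implicit Arguments.
Unset Strict Implicit.
Unset Printing Implicit Defensive.

Import Order.TTheory GRing.Theory Num.Theory.

Local Open Scope classical_set_scope.
Local Open Scope ring_scope.

(* The ground set [n] is 'I_n = {0, ..., n-1} with its usual order. *)

Record matroid (T : finType) := Matroid {
  bases : {set {set T}};
  bases_neq0 : bases != finset.set0;
  bases_exchange : forall A B : {set T}, A \in bases -> B \in bases ->
    forall x, x \in (A :\: B)%SET ->
    exists2 y, y \in (B :\: A)%SET & (y |: (A :\ x))%SET \in bases }.

Definition matroid_rank (T : finType) (M : matroid T) : nat :=
  (\max_(B in bases M) #|B|)%N.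

Section Positroid.
Variable R : realType.

Definition columns_independent d n (A : 'M[R]_(d, n)) : pred {set 'I_n} :=
  fun B => row_free (colsub (enum_val : 'I_#|B| -> 'I_n) A)^T.

Definition column_bases d n (A : 'M[R]_(d, n)) : {set {set 'I_n}} :=
  [set B : {set 'I_n} | maxset (columns_independent A) B]%SET.

(* The minors take the chosen columns in increasing order. *)
Definition maximal_minors_nonneg d n (A : 'M[R]_(d, n)) : Prop :=
  forall f : 'I_d -> 'I_n, {homo f : i j / (i < j)%N} -> 0 <= \det (colsub f A).

Definition positroid n (M : matroid 'I_n) : Prop :=
  exists d (A : 'M[R]_(d, n)),
    [/\ \rank A = d, maximal_minors_nonneg A & bases M = column_bases A].

End Positroid.

Section Polytope.
Variables (R : realType) (n : nat).
Implicit Types (P F S : set 'rV[R]_n).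

Definition convex_hull S : set 'rV[R]_n :=
  [set x | exists k (p : 'I_k -> 'rV[R]_n) (t : 'I_k -> R),
    [/\ forall i, S (p i), forall i, 0 <= t i, \sum_i t i = 1
      & x = \sum_i t i *: p i]].

Definition indicator_vector (B : {set 'I_n}) : 'rV[R]_n :=
  \sum_(i in B) delta_mx 0 i.

Definition matroid_polytope (M : matroid 'I_n) : set 'rV[R]_n :=
  convex_hull [set indicator_vector B | B in [set B | B \in bases M]].

Definition dot (c x : 'rV[R]_n) : R := \sum_i c 0 i * x 0 i.

(* c = 0 is allowed, so that P itself (b = 0) and the empty set (b = 1)
   are faces of P. *)
Definition face P F : Prop :=
  exists (c : 'rV[R]_n) (b : R),
    (forall x, P x -> dot c x <= b) /\ F = [set x | P x /\ dot c x = b].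

End Polytope.

Arguments matroid_polytope R {n} M _.

Definition cyclically_ordered n (a b c d : 'I_n) : bool :=
  [|| [&& a < b, b < c & c < d], [&& b < c, c < d & d < a],
      [&& c < d, d < a & a < b] | [&& d < a, a < b & b < c]]%N.

Definition noncrossing n (P : {set {set 'I_n}}) : bool :=
  [forall B in P, forall C in P, (B != C) ==>
    [forall a in B, forall c in B, forall b in C, forall d in C,
      ~~ cyclically_ordered a b c d]].

(* A weight function is stored as a function on all subsets of [n], with
   value 0 on the subsets which are not blocks, so that equality in NC is
   equality of weighted partitions.  The bound in 'I_n.+1 loses nothing as
   w B <= #|B| <= n; it makes NC n d finite. *)
Definition weighted_ncp n (d : nat)
    (Pw : {set {set 'I_n}} * {ffun {set 'I_n} -> 'I_n.+1}) : bool :=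
  let: (P, w) := Pw in
  [&& finset.partition P [set: 'I_n]%SET, noncrossing P,
      [forall B in P, w B <= #|B|]%N,
      [forall B, (B \notin P) ==> (w B == 0 :> nat)]
    & (\sum_(B in P) w B)%N == d].

Definition NC (n d : nat) : Type := {Pw | @weighted_ncp n d Pw}.

Section NCOrder.
Variables n d : nat.
Implicit Types sigma tau : NC n d.

Definition blocks sigma : {set {set 'I_n}} := (val sigma).1.
Definition weight sigma (B : {set 'I_n}) : nat := (val sigma).2 B.

(* NC_cover sigma tau: sigma is obtained from tau by splitting one block B of
   tau into A and B :\: A. *)
Definition NC_cover : rel (NC n d) := fun sigma tau =>
  [exists B in blocks tau, exists A : {set 'I_n},
    [&& (A != finset.set0) && (A \proper B),
        blocks sigma == (A |: ((B :\: A) |: (blocks tau :\ B)))%SET,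
        weight tau B == (weight sigma A + weight sigma (B :\: A)%SET)%N
      & [forall C in (blocks tau :\ B)%SET, weight tau C == weight sigma C]]].

Definition NC_le : rel (NC n d) := connect NC_cover.

(* NC_n^d with a new minimum element, represented by None. *)
Definition NC0_le : rel (option (NC n d)) := fun x y =>
  match x, y with
  | None, _ => true
  | Some _, None => false
  | Some sigma, Some tau => NC_le sigma tau
  end.

End NCOrder.

(* Main.v *)
(* A face of the matroid polytope is the convex hull of the indicator vectors
   of the bases maximizing a linear functional.  These bases again satisfy the
   exchange axiom, and the connected components of the matroid they form,
   weighted by rank, give the image of the face; the empty face goes to the
   minimum.

   The components are noncrossing: if single exchanges a -> c and b -> e in two
   different components crossed, then four bases a b S, c e S, c b S, a e S
   would exist, and in the three-term Pluecker relation
     [a b S][c e S] = [c b S][a e S] + [e b S][c a S]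
   nonnegativity of the minors forces the last product to be nonzero; by
   maximality of the weight c a S is then a basis of the face, so that b and c
   are exchangeable.

   The functional is constant on each component, so a face is cut out of the
   polytope by fixing the coordinate sums over its blocks.  Merging blocks only
   adds such equations, which gives one direction of the order equivalence.
   Conversely a noncrossing refinement is reached by splitting off, one at a
   time, the block whose minimum is the largest inside a given coarser block. *)

Require Import Defs.
From mathcomp Require Import all_boot all_order all_fingroup all_algebra.
From mathcomp Require Import reals ring lra zify.

Set Implicit Arguments.
Unset Strict Implicit.
Unset Printing Implicit Defensive.

Import Order.TTheory GRing.Theory Num.Theory.

Local Open Scope ring_scope.

(** * Signs of maximal minors *)

Section Minors.
Variables (R : realFieldType) (d n : nat).
Implicit Types (A : 'M[R]_(d, n)) (f g : 'I_d -> 'I_n).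

Definition upd f (p : 'I_d) (x : 'I_n) : 'I_d -> 'I_n :=
  fun i => if i == p then x else f i.

Definition minor A f : R := \det (colsub f A).

Lemma eq_minor A f g : f =1 g -> minor A f = minor A g.
Proof. by move=> fg; congr (\det _); apply/matrixP=> i j; rewrite !mxE fg. Qed.

(** Cofactors along column [p] do not see that column, so they are the same for [f] and [upd f p x];
    the right-hand side is the Laplace expansion. *)
Lemma minor_upd A f p x : minor A (upd f p x) = (\adj (colsub f A) *m A) p x.
Proof.
rewrite /minor (expand_det_col _ p) !mxE; apply: eq_bigr => k _.
rewrite !mxE /upd eqxx mulrC; congr (_ * \det _ * _).
by apply/matrixP=> i j; rewrite !mxE eq_sym (negPf (neq_lift _ _)).
Qed.

Lemma minor_repeat A f p q : p != q -> f p = f q -> minor A f = 0.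
Proof.
move=> npq fpq; rewrite /minor -det_tr.
by apply: (determinant_alternate npq) => k; rewrite !mxE fpq.
Qed.

Lemma minor_neq0_inj A f : minor A f != 0 -> injective f.
Proof.
move=> nz p q fpq; apply/eqP; apply: contraNT nz => npq.
by rewrite (minor_repeat _ npq fpq).
Qed.

(** With [F] and [G] the two column submatrices, both sides are the entry at [p], [f p] of
    [\adj F *m G *m \adj G *m A]: collapse [G *m \adj G] to a scalar for the left side, or read both
    factors by [minor_upd] for the right one. *)
Lemma plucker A f g p :
  minor A f * minor A g =
  \sum_i minor A (upd f p (g i)) * minor A (upd g i (f p)).
Proof.
under eq_bigr => i _ do rewrite !minor_upd.
set F := colsub f A; set G := colsub g A.
transitivity ((\adj F *m G *m (\adj G *m A)) p (f p)); last first.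
  rewrite mxE; apply: eq_bigr => i _; congr (_ * _).
  by rewrite !mxE; apply: eq_bigr => k _; rewrite !mxE.
rewrite mulmxA -(mulmxA (\adj F)) mul_mx_adj mul_mx_scalar -scalemxAl mxE.
have -> : (\adj F *m A) p (f p) = (\adj F *m F) p p.
  by rewrite !mxE; apply: eq_bigr => k _; rewrite !mxE.
by rewrite mul_adj_mx mxE eqxx mulrC.
Qed.

Definition upd2 g p q x y := upd (upd g p x) q y.

(** In the Pluecker relation at position [p], every index other than [p] and [q] contributes a minor
    with a repeated column. *)
Lemma three_term A g p q a b c e : p != q ->
  minor A (upd2 g p q a b) * minor A (upd2 g p q c e) =
  minor A (upd2 g p q c b) * minor A (upd2 g p q a e) +
  minor A (upd2 g p q e b) * minor A (upd2 g p q c a).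
Proof.
move=> npq; rewrite (plucker _ _ _ p) (bigD1 p) //= (bigD1 q) 1?eq_sym //=.
rewrite big1 ?addr0 => [|i /andP[nip niq]].
  congr (_ * _ + _ * _); apply: eq_minor => i;
    rewrite /upd2 /upd ?eqxx ?(eq_sym q) ?(negPf npq);
    by case: (eqVneq i q) => [eiq|_]; case: (eqVneq i p) => [eip|_] //=;
      rewrite -eiq eip eqxx in npq.
rewrite (@minor_repeat A _ p i) ?mul0r 1?eq_sym //.
by rewrite /upd2 /upd eqxx (negPf nip) (negPf niq).
Qed.

(** A reference matrix whose increasing maximal minors are all positive and whose minors factor over
    pairs of positions. *)
Definition vdm : 'M[R]_(d, n) := Vandermonde d (\row_(j < n) (j : nat)%:R).

Lemma minor_vdm f :
  minor vdm f = \prod_(z : 'I_d * 'I_d | (z.1 < z.2)%N) ((f z.2)%:R - (f z.1)%:R).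
Proof.
have -> : minor vdm f = \det (Vandermonde d (\row_j ((f j : nat)%:R : R))).
  by congr (\det _); apply/matrixP=> i j; rewrite !mxE.
rewrite det_Vandermonde pair_big_dep /=.
by apply: eq_bigr => z _; rewrite !mxE.
Qed.

Lemma minor_vdm_neq0 f : injective f -> minor vdm f != 0.
Proof.
move=> fI; rewrite minor_vdm; apply/prodf_neq0 => -[i j] /= lij.
by rewrite subr_eq0 eqr_nat; apply: contraTneq lij => /val_inj/fI ->; rewrite ltnn.
Qed.

(* The Vandermonde minor has the sign of the permutation sorting [f]. *)
Lemma minor_vdm_ge0 A f :
  (forall g, {homo g : i j / (i < j)%N} -> 0 <= \det (colsub g A)) ->
  injective f -> 0 <= minor A f * minor vdm f.
Proof.
move=> Apos fI.
(* [rk i] is the position of [f i] among the sorted values of [f]; it gives the permutation [s]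
   turning [f] into the increasing map [g]. *)
have rkP i : (#|[set k | (f k < f i)%N]| < d)%N.
  rewrite -[X in (_ < X)%N]card_ord -cardsT; apply: proper_card; rewrite properE subsetT /=.
  by apply/subsetPn; exists i; rewrite !inE ?ltnn.
pose rk i := Ordinal (rkP i).
have rk_lt i j : (f i < f j)%N -> (rk i < rk j)%N.
  move=> lij; apply: proper_card; rewrite properE; apply/andP; split.
    by apply/subsetP => k; rewrite !inE => /ltn_trans; apply.
  by apply/subsetPn; exists i; rewrite !inE ?ltnn.
have rk_inj : injective rk.
  move=> i j eij; apply: fI; apply/val_inj.
  by case: (ltngtP (f i) (f j)) => // /rk_lt; rewrite eij ltnn.
pose s := perm rk_inj; pose g i := f (s^-1%g i).
have gmono : {homo g : i j / (i < j)%N}.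
  move=> i j lij; rewrite ltnNge; apply: contraTN lij; rewrite -leqNgt.
  have -> : i = rk (s^-1%g i) by rewrite -[LHS](permKV s) permE.
  have -> : j = rk (s^-1%g j) by rewrite -[LHS](permKV s) permE.
  rewrite /g; move: (s^-1%g i) (s^-1%g j) => u v; rewrite -!(permE rk_inj) !permK !permE.
  by rewrite leq_eqVlt => /orP[/eqP/val_inj/fI ->|/rk_lt/ltnW].
have minorE B : minor B f = (-1) ^+ s * \det (colsub g B).
  have -> : minor B f = \det (col_perm s (colsub g B)).
    by congr (\det _); apply/matrixP=> i j; rewrite !mxE /g permK.
  by rewrite col_permE det_mulmx det_perm mulrC odd_permV.
rewrite !minorE mulrACA -expr2 sqrr_sign mul1r mulr_ge0 ?Apos //.
rewrite -/(minor _ _) minor_vdm prodr_ge0 // => -[i j] /= /gmono lij.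
by rewrite subr_ge0 ler_nat ltnW.
Qed.

(* For distinct elements: the chords ac and be cross.  In this form the
   predicate is additive along paths from a to c and from b to e. *)
Definition crossing (a c b e : 'I_n) : bool :=
  (a < b)%N (+) (c < b)%N (+) (a < e)%N (+) (c < e)%N.

(* The first two products of [three_term] have opposite signs, so the third one
   does not vanish. *)
Lemma crossing_minor A g p q a b c e :
  (forall f, {homo f : i j / (i < j)%N} -> 0 <= \det (colsub f A)) ->
  p != q -> crossing a c b e ->
  minor A (upd2 g p q a b) != 0 -> minor A (upd2 g p q c e) != 0 ->
  minor A (upd2 g p q c b) != 0 -> minor A (upd2 g p q a e) != 0 ->
  minor A (upd2 g p q e b) != 0 /\ minor A (upd2 g p q c a) != 0.
Proof.
move=> Apos npq cr nab nce ncb nae; apply/andP; rewrite -negb_or -mulf_eq0.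
pose F z := upd2 g p q z.1 z.2.
have inj z : minor A (F z) != 0 -> injective (F z) by exact: minor_neq0_inj.
have vge z : minor A (F z) != 0 -> 0 <= minor A (F z) * minor vdm (F z).
  by move=> nz; apply: minor_vdm_ge0 => //; apply: inj.
pose D (z : 'I_d * 'I_d) (h : 'I_d -> 'I_n) : R := (h z.2)%:R - (h z.1)%:R.
(* The factors belonging to the pair [z] in the four Vandermonde minors, whose product is compared
   with the four minors of [A]. *)
pose T z := D z (F (a, b)) * D z (F (c, e)) * D z (F (c, b)) * D z (F (a, e)).
have Fp x y : F (x, y) p = x by rewrite /F /upd2 /upd eqxx (negPf npq).
have Fq x y : F (x, y) q = y by rewrite /F /upd2 /upd eqxx.
have Fo i x y : i != p -> i != q -> F (x, y) i = g i.
  by move=> /negPf np /negPf nq; rewrite /F /upd2 /upd np nq.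
have neq x y : minor A (F (x, y)) != 0 -> x != y.
  move=> /inj FI; apply: contra npq => /eqP exy.
  by apply/eqP/FI; rewrite Fp Fq.
(* Here the factors are the four differences between [a], [c] and [b], [e]; crossing means that an
   odd number of them is negative. *)
have Tpair : T (p, q) < 0.
  have nz x y : minor A (F (x, y)) != 0 -> (y%:R - x%:R : R) != 0.
    by move=> /neq; rewrite subr_eq0 eqr_nat eq_sym.
  rewrite /T /D /= !Fp !Fq !neq0_mulr_lt0 ?mulf_neq0 ?nz //.
  rewrite !subr_lt0 !ltr_nat; move: cr (neq _ _ nab) (neq _ _ nce) (neq _ _ ncb) (neq _ _ nae).
  by rewrite /crossing -!val_eqE /=; case: (ltngtP a b); case: (ltngtP c b);
    case: (ltngtP a e); case: (ltngtP c e).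
have Tpair' : T (q, p) < 0.
  suff -> : T (q, p) = T (p, q) by [].
  by rewrite /T /D /=; ring.
(* Each of [a], [b], [c], [e] occurs once in the first two minors and once in the last two, so for
   any other pair the factors form a square. *)
have Tother z : z != (p, q) -> z != (q, p) -> 0 <= T z.
  case: z => i j; rewrite !xpair_eqE /T /D /=.
  have sq (x y u v : R) : x * y = u * v -> 0 <= x * y * u * v.
    by move=> xy; rewrite -mulrA -xy -expr2 sqr_ge0.
  case: (eqVneq i p) => [eip|ip]; case: (eqVneq j p) => [ejp|jp];
  case: (eqVneq i q) => [eiq|iq]; case: (eqVneq j q) => [ejq|jq] //= _ _;
  subst; rewrite ?Fp ?Fq ?Fo //; apply: sq; ring.
have T0 : minor vdm (F (a, b)) * minor vdm (F (c, e)) * minor vdm (F (c, b)) *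
   minor vdm (F (a, e)) < 0.
  rewrite lt_neqAle; apply/andP; split.
    by rewrite !mulf_neq0 //; apply: minor_vdm_neq0; apply: inj.
  rewrite !minor_vdm -!big_split /=.
  pose z0 := if (p < q)%N then (p, q) else (q, p).
  rewrite (bigD1 z0) /=; last first.
    by rewrite /z0; case: (ltngtP p q) => //= /val_inj epq; rewrite epq eqxx in npq.
  rewrite mulr_le0_ge0 //.
    by rewrite /z0; case: ifP => _; apply: ltW.
  apply: prodr_ge0 => z /andP[lz nz]; apply: Tother; apply: contraNneq nz => ez;
  by move: lz; rewrite ez /z0 /= => lpq; rewrite ?lpq // ltnNge (ltnW lpq).
have E : minor A (F (a, b)) * minor A (F (c, e)) =
    minor A (F (c, b)) * minor A (F (a, e)) + minor A (F (e, b)) * minor A (F (c, a)).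
  exact: three_term.
change (minor A (F (e, b)) * minor A (F (c, a)) != 0).
(* If the last product vanished, the first two would be equal; then the nonnegative number [V] would
   be a positive square times the negative product [T0]. *)
apply: contraTneq T0 => E0; rewrite E0 addr0 in E.
rewrite -leNgt.
have := mulr_ge0 (mulr_ge0 (vge (a, b) nab) (vge (c, e) nce))
  (mulr_ge0 (vge (c, b) ncb) (vge (a, e) nae)).
set V := (X in 0 <= X).
have -> : V = (minor A (F (a, b)) * minor A (F (c, e))) ^+ 2 *
  (minor vdm (F (a, b)) * minor vdm (F (c, e)) * minor vdm (F (c, b)) *
   minor vdm (F (a, e))).
  by rewrite /V expr2 {2}E; ring.
by rewrite pmulr_rge0 // exprn_even_gt0 //= mulf_neq0.
Qed.
End Minors.

(** * Exchange and connected components *)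

Section Enumeration.
Variable T : finType.

Lemma enum_set_inj (B : {set T}) d : #|B| = d ->
  exists2 f : 'I_d -> T, injective f & f @: setT = B.
Proof.
move=> <-; exists enum_val; first exact: enum_val_inj.
apply/setP => x; apply/imsetP/idP => [[i _ ->]|xB]; first exact: enum_valP.
by exists (enum_rank_in xB x); rewrite ?inE ?enum_rankK_in.
Qed.

End Enumeration.

Lemma imset_upd d n (f : 'I_d -> 'I_n) p x : injective f ->
  upd f p x @: setT = x |: (f @: setT :\ f p).
Proof.
move=> fI; apply/setP => y; rewrite !inE; apply/imsetP/idP => [[i _ ->]|].
  rewrite /upd; case: (eqVneq i p) => [_|nip]; first by rewrite eqxx.
  by rewrite (inj_eq fI) nip imset_f ?orbT ?inE.
case/orP => [/eqP->|/andP[ny /imsetP[i _ yE]]]; first by exists p; rewrite /upd ?eqxx.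
exists i => //; rewrite /upd ifN //; apply: contraNneq ny => <-; exact/eqP.
Qed.

(** * Bases of the column matroid as nonvanishing maximal minors *)

Section ColumnBases.
Variables (R : realType) (d n : nat) (A : 'M[R]_(d, n)).

(** Frees [columns_independent] from the particular enumeration [enum_val] of a set of columns. *)
Lemma rank_colsub k l (f : 'I_k -> 'I_n) (g : 'I_l -> 'I_n) :
  f @: setT = g @: setT -> \rank (colsub f A)^T = \rank (colsub g A)^T.
Proof.
move=> fg; have sub k1 k2 (f1 : 'I_k1 -> 'I_n) (f2 : 'I_k2 -> 'I_n) :
    f1 @: setT = f2 @: setT -> ((colsub f1 A)^T <= (colsub f2 A)^T)%MS.
  move=> f12; apply/row_subP => i.
  have /imsetP[j _ ij] : f1 i \in f2 @: setT by rewrite -f12 imset_f.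
  suff -> : row i (colsub f1 A)^T = row j (colsub f2 A)^T by exact: row_sub.
  by apply/rowP => k0; rewrite !mxE ij.
by apply/eqP; rewrite eqn_leq !mxrankS // sub.
Qed.

Lemma columns_independentE k (f : 'I_k -> 'I_n) : injective f ->
  columns_independent A (f @: setT) = row_free (colsub f A)^T.
Proof.
move=> fI; rewrite /columns_independent /row_free (@rank_colsub _ k _ f).
  by rewrite card_imset // cardsT card_ord.
apply/setP => x; apply/imsetP/idP => [[i _ ->]|xf]; first exact: enum_valP.
by exists (enum_rank_in xf x); rewrite ?inE ?enum_rankK_in.
Qed.

Lemma minor_neq0P (f : 'I_d -> 'I_n) :
  reflect (injective f /\ f @: setT \in column_bases A) (minor A f != 0).
Proof.
have unitE : (minor A f != 0) = row_free (colsub f A)^T.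
  by rewrite row_free_unit unitmx_tr unitmxE unitfE.
apply: (iffP idP) => [nz|[fI]]; last first.
  by rewrite inE => /maxsetP[]; rewrite columns_independentE // unitE.
have fI := minor_neq0_inj nz; split=> //; rewrite inE; apply/maxsetP.
(* Maximality: an independent set of columns has at most [d] elements, the number of rows. *)
split=> [|C indC sC]; first by rewrite columns_independentE // -unitE.
apply/esym/eqP; rewrite eqEcard sC card_imset // cardsT card_ord.
by move: indC; rewrite /columns_independent /row_free => /eqP <-; exact: rank_leq_col.
Qed.

Lemma exists_minor_neq0 : \rank A = d -> exists f : 'I_d -> 'I_n, minor A f != 0.
Proof.
move=> rA; have fullA : row_full A^T by rewrite /row_full mxrank_tr rA.
exists (fullrankfun fullA); have := fullrowsub_unit fullA.
rewrite unitmxE unitfE -det_tr; congr (\det _ != 0).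
by apply/matrixP => i j; rewrite !mxE.
Qed.

End ColumnBases.

(** * Set systems with the exchange property, their separators and components *)

Section SetSystem.
Variable T : finType.
Implicit Types (Bs : {set {set T}}) (A B U : {set T}).

Definition basis_exchange Bs := forall A B, A \in Bs -> B \in Bs ->
  forall x, x \in A :\: B -> exists2 y, y \in B :\: A & y |: A :\ x \in Bs.

(** For the bases of a matroid this relation says that [x] and [y] are distinct elements of a common
    circuit, so its classes are the connected components. *)
Definition exchangeable Bs : rel T := fun x y =>
  [exists B in Bs, [&& x \in B, y \notin B & y |: B :\ x \in Bs]].

Definition exchange_closed Bs U :=
  forall x y, exchangeable Bs x y -> (x \in U) = (y \in U).

Lemma exchangeable_sym Bs : symmetric (exchangeable Bs).
Proof.
suff H x y : exchangeable Bs x y -> exchangeable Bs y x by move=> x y; apply/idP/idP => /H.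
case/existsP => B /and4P[BBs xB yB B'Bs]; apply/existsP; exists (y |: B :\ x).
have nxy : x != y by apply: contraNneq yB => <-.
rewrite B'Bs !inE eqxx (negPf nxy) /=.
suff -> : x |: (y |: B :\ x) :\ y = B by rewrite eqxx BBs.
apply/setP => z; rewrite !inE; case: (eqVneq z x) => [->|_] /=; first by rewrite xB.
by case: (eqVneq z y) => [->|_] //=; rewrite (negPf yB).
Qed.

Lemma sum_exchange (V : zmodType) (w : T -> V) A x y : x \in A -> y \notin A ->
  \sum_(i in y |: A :\ x) w i = \sum_(i in A) w i - w x + w y.
Proof.
move=> xA yA; rewrite big_setU1 ?inE ?(negPf yA) ?andbF //.
by rewrite (big_setD1 x xA) /= [w x + _]addrC addrK addrC.
Qed.

Lemma card_exchange U A x y : x \in A -> y \notin A -> (x \in U) = (y \in U) ->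
  #|(y |: A :\ x) :&: U| = #|A :&: U|.
Proof.
have cE B : #|B :&: U| = (\sum_(i in B) (i \in U))%N.
  by rewrite -sum1_card big_mkcond [RHS]big_mkcond; apply: eq_bigr => i _;
    rewrite inE; case: (i \in B); case: (i \in U).
move=> xA yA xy; rewrite !cE big_setU1 ?inE ?(negPf yA) ?andbF //.
by rewrite (big_setD1 x xA) /= xy.
Qed.

(** Exchange the elements of [A] outside [U] and [B], one at a time, for elements of [B]. Such an
    exchange never enters [U], since [U] is closed, and it preserves the trace size on every closed
    set. *)
Lemma exchange_toward Bs U A B : basis_exchange Bs -> exchange_closed Bs U ->
  A \in Bs -> B \in Bs -> exists2 C, C \in Bs &
  [/\ C :&: U = A :&: U, C :\: U \subset B &
     forall V, exchange_closed Bs V -> #|C :&: V| = #|A :&: V|].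
Proof.
move=> ex clU; have [k] := ubnP #|A :\: U :\: B|; elim: k A => // k IH A ltk ABs BBs.
have [sAB|/subsetPn[x]] := boolP (A :\: U \subset B); first by exists A.
rewrite inE => /andP[xU xA] xB.
have [|y] := ex A B ABs BBs x; first by rewrite inE xA xB.
rewrite inE => /andP[yA yB] CBs.
have exy : exchangeable Bs x y by apply/existsP; exists A; rewrite ABs xA yA.
have yU : y \notin U by rewrite -(clU _ _ exy).
have ltC : (#|(y |: A :\ x) :\: U :\: B| < k)%N.
  apply: leq_trans (ltk : (_ <= k)%N); apply: proper_card; apply/properP; split.
    apply/subsetP => z; rewrite !inE => /and3P[zB -> zC]; rewrite zB /=; move: zC zB.
    by case: (eqVneq z y) => [->|_ /andP[]] //; rewrite yB.
  exists x; first by rewrite !inE xU xB xA.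
  by rewrite !inE eqxx orbF xB xU; apply: contraNneq yA => <-.
have [D DBs [DU DB DV]] := IH _ ltC CBs BBs.
exists D => //; split=> //.
  rewrite DU; apply/setP => z; rewrite !inE; case: (eqVneq z y) => [->|_] /=.
    by rewrite (negPf yU) !andbF.
  by case: (eqVneq z x) => [->|] //=; rewrite (negPf xU) andbF.
by move=> V clV; rewrite DV // card_exchange //; apply: clV.
Qed.

Lemma exchange_closed_card Bs U A B : basis_exchange Bs -> exchange_closed Bs U ->
  A \in Bs -> B \in Bs -> #|A :&: U| = #|B :&: U|.
Proof.
move=> ex clU ABs BBs.
(* With [U] empty, [A] is moved to a basis [C] inside [B]; exchange forces [C] to equal [B]. *)
have [|C CBs [_ sCB CV]] := exchange_toward (U := set0) ex _ ABs BBs.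
  by move=> x y _; rewrite !inE.
rewrite -CV //; congr #|_ :&: _|; apply/eqP; rewrite setD0 in sCB.
rewrite eqEsubset sCB; apply/subsetP => x xB; apply/negPn/negP => xC.
have [|y] := ex B C BBs CBs x; first by rewrite inE xB xC.
by rewrite inE => /andP[yB /(subsetP sCB)]; rewrite (negPf yB).
Qed.

Lemma basis_card Bs A B : basis_exchange Bs -> A \in Bs -> B \in Bs -> #|A| = #|B|.
Proof.
move=> ex ABs BBs; have := @exchange_closed_card Bs setT A B ex _ ABs BBs.
by rewrite !setIT; apply=> x y _; rewrite !inE.
Qed.

(** The direct sum decomposition along a separator: the basis obtained from [A] by moving toward [B]
    outside [U] is the mixed set, by counting on the complement, which is closed too. *)
Lemma exchange_closed_mix Bs U A B : basis_exchange Bs -> exchange_closed Bs U ->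
  A \in Bs -> B \in Bs -> (A :&: U) :|: (B :\: U) \in Bs.
Proof.
move=> ex clU ABs BBs.
have [C CBs [CU sCB CV]] := exchange_toward ex clU ABs BBs.
suff <- : C = (A :&: U) :|: (B :\: U) by [].
rewrite -CU -{1}(setID C U); congr (_ :|: _); apply/eqP.
rewrite eqEcard; apply/andP; split.
  by apply/subsetP => x xC; rewrite inE (subsetP sCB) // andbT; move: xC; rewrite inE => /andP[].
rewrite !setDE; have clU' : exchange_closed Bs (~: U).
  by move=> x y /clU; rewrite !inE => ->.
by rewrite (exchange_closed_card ex clU' CBs BBs).
Qed.

Definition components Bs : {set {set T}} :=
  equivalence_partition (connect (exchangeable Bs)) [set: T].

Lemma connect_exchangeable_sym Bs : connect_sym (exchangeable Bs).
Proof. exact/sym_connect_sym/exchangeable_sym. Qed.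

Lemma connect_exchangeable_equiv Bs :
  {in [set: T] & &, equivalence_rel (connect (exchangeable Bs))}.
Proof.
move=> x y z _ _ _; split=> [|xy]; first exact: connect0.
exact: (same_connect (@connect_exchangeable_sym Bs)).
Qed.

Lemma components_partition Bs : finset.partition (components Bs) [set: T].
Proof. exact/equivalence_partitionP/connect_exchangeable_equiv. Qed.

Lemma mem_component Bs C x y : C \in components Bs -> x \in C ->
  (y \in C) = connect (exchangeable Bs) x y.
Proof.
move=> CP xC; have /and3P[_ tI _] := components_partition Bs.
rewrite -(def_pblock tI CP xC) pblock_equivalence_partition ?inE //.
exact: connect_exchangeable_equiv.
Qed.

Lemma component_closed Bs C : C \in components Bs -> exchange_closed Bs C.
Proof.
move=> CP x y exy; apply/idP/idP => [xC|yC].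
  by rewrite (mem_component _ CP xC) connect1.
by rewrite (mem_component _ CP yC) connect1 // exchangeable_sym.
Qed.

Lemma components_refine Bs Bs' C : {subset Bs <= Bs'} -> C \in components Bs ->
  exists2 D, D \in components Bs' & C \subset D.
Proof.
move=> sBs CP; have /and3P[/eqP covD _ _] := components_partition Bs'.
have /and3P[_ _ n0] := components_partition Bs.
have /set0Pn[x xC] : C != set0 by apply: contraNneq n0 => <-.
have xcov : x \in cover (components Bs') by rewrite covD inE.
exists (pblock (components Bs') x); first exact: pblock_mem.
apply/subsetP => y; rewrite (mem_component _ CP xC) => xy.
rewrite (@mem_component Bs' _ x) ?pblock_mem ?mem_pblock //.
apply: connect_sub xy => u v /existsP[B /and4P[BBs uB vB B'Bs]].
by apply/connect1/existsP; exists B; rewrite sBs // uB vB sBs.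
Qed.

End SetSystem.

(** * Noncrossing components *)

(** What the three-term relation and the signs of the minors say about bases alone; in this form the
    property passes to the bases of a face. *)
Definition crossing_exchange n (Bs : {set {set 'I_n}}) :=
  forall (a b c e : 'I_n) (S : {set 'I_n}), crossing a c b e -> uniq [:: a; b; c; e] ->
  [&& a \notin S, b \notin S, c \notin S & e \notin S] ->
  [&& a |: (b |: S) \in Bs, c |: (e |: S) \in Bs,
      c |: (b |: S) \in Bs & a |: (e |: S) \in Bs] ->
  (e |: (b |: S) \in Bs) && (c |: (a |: S) \in Bs).

Lemma connect_invariant (T : finType) (V : Type) (e : rel T) (psi : T -> V) x y :
  (forall u v, connect e x u -> e u v -> psi u = psi v) ->
  connect e x y -> psi x = psi y.
Proof.
move=> inv /connectP[s sP ->]; elim/last_ind: s sP => // s z IH.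
rewrite rcons_path last_rcons => /andP[sP ez]; rewrite (IH sP).
by apply: inv ez; apply/connectP; exists s.
Qed.

Lemma cyclically_ordered_crossing n (a b c e : 'I_n) :
  cyclically_ordered a b c e -> crossing a c b e.
Proof.
case/or4P => /and3P[l1 l2 l3]; rewrite /crossing.
- have -> : (a < b)%N by []. have -> : (c < b)%N = false by lia.
  have -> : (a < e)%N by lia. by rewrite l3.
- have -> : (a < b)%N = false by lia. have -> : (c < b)%N = false by lia.
  have -> : (a < e)%N = false by lia. by rewrite l2.
- have -> : (a < b)%N by []. have -> : (c < b)%N by lia.
  have -> : (a < e)%N = false by lia. by rewrite l1.
- have -> : (a < b)%N by []. have -> : (c < b)%N = false by lia.
  have -> : (a < e)%N = false by lia. have -> : (c < e)%N = false by lia. by [].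
Qed.

Lemma setU1_mix (T : finType) (U X Y : {set T}) x y : x \in U -> y \notin U ->
  ((x |: X) :&: U) :|: ((y |: Y) :\: U) = x |: (y |: ((X :&: U) :|: (Y :\: U))).
Proof.
move=> xU yU; apply/setP => z; rewrite !inE.
case: (eqVneq z x) => [zx|_]; first by rewrite zx xU.
by case: (eqVneq z y) => [zy|_] //=; rewrite zy (negPf yU) orbT.
Qed.

Lemma components_noncrossing n (Bs : {set {set 'I_n}}) :
  basis_exchange Bs -> crossing_exchange Bs -> noncrossing (components Bs).
Proof.
move=> ex cr.
(* First the case of two single exchanges in different components. *)
have key a c b e : exchangeable Bs a c -> exchangeable Bs b e ->
    ~~ connect (exchangeable Bs) a b -> ~~ crossing a c b e.
  move=> ac be nab.
  set U := [set x | connect (exchangeable Bs) a x].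
  have csym := @connect_exchangeable_sym _ Bs.
  have clU : exchange_closed Bs U.
    by move=> x y xy; rewrite !inE; apply: (same_connect_r csym); exact: connect1.
  have aU : a \in U by rewrite inE connect0.
  have cU : c \in U by rewrite -(clU _ _ ac).
  have bU : b \notin U by rewrite inE.
  have eU : e \notin U by rewrite -(clU _ _ be).
  apply/negP => cross.
  case/existsP: (ac) => B /and4P[BBs aB cB B1Bs].
  case/existsP: (be) => B' /and4P[BBs' bB eB B1Bs'].
  (* Gluing the two exchanges along the component [U] of [a]: adding to [S] one of [a], [c] and one
     of [b], [e] always gives a basis. *)
  pose S := ((B :\ a) :&: U) :|: ((B' :\ b) :\: U).
  have nac : a != c by apply: contraNneq cB => <-.
  have nbe : b != e by apply: contraNneq eB => <-.
  have nUU x y : x \in U -> y \notin U -> x != y by move=> xU; apply: contraNneq => <-.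
  have mix X Y x y : x \in U -> y \notin U -> X \in Bs -> Y \in Bs ->
      X = x |: B :\ a -> Y = y |: B' :\ b -> x |: (y |: S) \in Bs.
    move=> xU yU XBs YBs EX EY; have := exchange_closed_mix ex clU XBs YBs.
    by rewrite EX EY setU1_mix.
  have EB : B = a |: B :\ a by rewrite setD1K.
  have EB' : B' = b |: B' :\ b by rewrite setD1K.
  have := cr a b c e S cross.
  rewrite (mix B B') ?(mix _ B' c b _ _ B1Bs) ?(mix B _ a e _ _ _ B1Bs')
    ?(mix _ _ c e _ _ B1Bs B1Bs') //=.
  have inS x : (x \in S) = if x \in U then (x != a) && (x \in B) else (x != b) && (x \in B').
    by rewrite in_setU in_setI in_setD1 in_setD in_setD1; case: (x \in U);
      rewrite ?andbF ?andbT ?orbF.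
  have aS : a \notin S by rewrite inS aU eqxx.
  have bS : b \notin S by rewrite inS (negPf bU) eqxx.
  have cS : c \notin S by rewrite inS cU (negPf cB) andbF.
  have eS : e \notin S by rewrite inS (negPf eU) (negPf eB) andbF.
  clearbody S.
  rewrite aS bS cS eS /= !inE !negb_or.
  rewrite nac nbe (nUU a b) // (nUU a e) // (eq_sym b c) (nUU c b) // (nUU c e) //=.
  case/(_ isT isT isT)/andP => _ caBs.
  have abBs := mix B B' a b aU bU BBs BBs' EB EB'.
  (* The bases [a |: (b |: S)] and [c |: (a |: S)] differ by exchanging [b] for [c], which lie on
     different sides of [U]. *)
  suff bc : exchangeable Bs b c by rewrite (clU _ _ bc) cU in bU.
  apply/existsP; exists (a |: (b |: S)); rewrite abBs !inE eqxx orbT /=.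
  rewrite (negPf cS) orbF negb_or (eq_sym c a) nac (nUU c b) //=.
  suff -> : (a |: (b |: S)) :\ b = a |: S by [].
  by rewrite setUCA setU1K // !inE negb_or (eq_sym b a) (nUU a b).
move=> *; apply/'forall_implyP => C CP.
apply/'forall_implyP => D DP; apply/implyP => nCD.
apply/'forall_implyP => a aC; apply/'forall_implyP => c cC.
apply/'forall_implyP => b bD; apply/'forall_implyP => e eD.
have csym := @connect_exchangeable_sym _ Bs.
have conn : connect (exchangeable Bs) a c by rewrite -(mem_component _ CP aC).
have conn' : connect (exchangeable Bs) b e by rewrite -(mem_component _ DP bD).
have nconn : ~~ connect (exchangeable Bs) a b.
  rewrite -(mem_component _ CP aC); apply: contra nCD => bC; apply/eqP.
  have /and3P[_ tI _] := components_partition Bs.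
  by rewrite -(def_pblock tI CP bC) -(def_pblock tI DP bD).
have nconn2 u v : connect (exchangeable Bs) a u -> connect (exchangeable Bs) b v ->
    ~~ connect (exchangeable Bs) u v.
  move=> au bv; apply: contra nconn => uv; apply: (connect_trans au).
  by apply: (connect_trans uv); rewrite csym.
(* The parity defining [crossing] is additive: sum it first along a path from [b] to [e] with the
   exchange of [u] and [v] fixed, then along a path from [a] to [c]. *)
have step u v : connect (exchangeable Bs) a u -> exchangeable Bs u v ->
    (u < b)%N (+) (v < b)%N = (u < e)%N (+) (v < e)%N.
  move=> au uv; pose psi (z : 'I_n) := (u < z)%N (+) (v < z)%N.
  apply: (@connect_invariant _ _ _ psi _ _ _ conn').
  move=> x y bx xy; have := key u v x y uv xy (nconn2 _ _ au bx).
  by rewrite /crossing /psi; do 4!case: (_ < _)%N.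
have : (a < b)%N (+) (a < e)%N = (c < b)%N (+) (c < e)%N.
  apply: (@connect_invariant _ _ _ (fun z : 'I_n => (z < b)%N (+) (z < e)%N) _ _ _ conn).
  move=> u v au uv; have := step u v au uv.
  by case: (u < b)%N; case: (v < b)%N; case: (u < e)%N; case: (v < e)%N.
move=> E; apply/negP => /cyclically_ordered_crossing; rewrite /crossing; move: E.
by do 4!case: (_ < _)%N.
Qed.

(** * Bases of a positroid and of its faces *)

Definition symmetric_exchange (T : finType) (Bs : {set {set T}}) :=
  forall A B, A \in Bs -> B \in Bs -> forall x, x \in A :\: B ->
  exists2 y, y \in B :\: A & (y |: A :\ x \in Bs) && (x |: B :\ y \in Bs).

Lemma imset_upd2 d n (g : 'I_d -> 'I_n) p q x y : injective g -> p != q ->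
  upd2 g p q x y @: setT = x |: (y |: (g @: setT :\ g p :\ g q)).
Proof.
move=> gI npq; apply/setP => z; rewrite !inE; apply/imsetP/idP => [[i _ ->]|].
  rewrite /upd2 /upd; case: (eqVneq i q) => [_|niq]; first by rewrite eqxx orbT.
  case: (eqVneq i p) => [_|nip]; first by rewrite eqxx.
  by rewrite !(inj_eq gI) nip niq imset_f ?orbT ?inE.
case/or3P => [/eqP->|/eqP->|/and3P[nq np /imsetP[i _ zE]]].
- by exists p; rewrite // /upd2 /upd eqxx (negPf npq).
- by exists q; rewrite // /upd2 /upd eqxx.
- move: nq np; rewrite zE !(inj_eq gI) => /negPf niq /negPf nip.
  by exists i => //; rewrite /upd2 /upd niq nip.
Qed.

Lemma imset_card_inj d n (f : 'I_d -> 'I_n) : #|f @: setT| = d -> injective f.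
Proof.
move=> fd; have /imset_injP fI : #|f @: setT| == #|[set: 'I_d]| by rewrite fd cardsT card_ord.
by move=> i j; apply: fI; rewrite inE.
Qed.

Section Positroid.
Variables (R : realType) (n : nat) (M : matroid 'I_n).
Hypothesis posM : positroid R M.

Lemma matroid_basis_exchange : basis_exchange (bases M).
Proof. exact: bases_exchange. Qed.

(** The facts through which the matrix is used below. For a non-injective [f] the minor vanishes and
    the image is too small to be a basis. *)
Lemma positroid_minors : exists d (A : 'M[R]_(d, n)),
  [/\ forall f : 'I_d -> 'I_n, {homo f : i j / (i < j)%N} -> 0 <= \det (colsub f A),
      forall f, (minor A f != 0) = (f @: setT \in bases M)
    & forall B, B \in bases M -> #|B| = d].
Proof.
case: posM => d [A [rA Apos EM]]; exists d, A.
have cardM B : B \in bases M -> #|B| = d.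
  have [f /minor_neq0P[fI fB]] := exists_minor_neq0 rA.
  rewrite -EM in fB => BM; rewrite (basis_card matroid_basis_exchange BM fB).
  by rewrite card_imset // cardsT card_ord.
split=> // f; apply/minor_neq0P/idP => [[_]|fM]; rewrite -EM //.
by split=> //; apply/imset_card_inj/cardM.
Qed.

(** The product of the minors of the two bases is nonzero, so some term of its Pluecker expansion is
    nonzero; both factors of that term are minors of bases. *)
Lemma positroid_symmetric_exchange : symmetric_exchange (bases M).
Proof.
have [d [A [_ minorE cardM]]] := positroid_minors.
move=> B C BM CM x; rewrite inE => /andP[xC xB].
have [f fI fB] := enum_set_inj (cardM _ BM).
have [g gI gC] := enum_set_inj (cardM _ CM).
have /imsetP[p _ xp] : x \in f @: setT by rewrite fB.
have nz : minor A f * minor A g != 0 by rewrite mulf_neq0 // minorE ?fB ?gC.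
have [i nzi] : exists i, minor A (upd f p (g i)) * minor A (upd g i (f p)) != 0.
  apply/existsP; apply: contraNT nz => /existsPn z.
  by rewrite (plucker _ _ _ p) big1 // => i _; apply/eqP/negPn.
move: nzi; rewrite mulf_eq0 negb_or => /andP[fu gu].
have fuI := minor_neq0_inj fu; move: fu gu; rewrite !minorE => fu gu.
have giC : g i \in C by rewrite -gC imset_f.
exists (g i); last by rewrite -fB -gC xp -!imset_upd // fu.
(* If [g i] were already in the first basis, [upd f p (g i)] would repeat a column. *)
rewrite inE giC andbT -fB; apply/imsetP => -[j _ gij].
have njp : j != p by apply: contraNneq xC => jp; rewrite xp -jp -gij.
by case/eqP: (njp); apply: fuI; rewrite /upd eqxx (negPf njp).
Qed.

Lemma positroid_crossing_exchange : crossing_exchange (bases M).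
Proof.
have [d [A [Apos minorE cardM]]] := positroid_minors.
move=> a b c e S cr; rewrite /= !inE !negb_or => /and4P[/and3P[ab _ _] _ _ _].
case/and4P => aS bS _ _ /and4P[abM ceM cbM aeM].
have [g gI gB] := enum_set_inj (cardM _ abM).
have /imsetP[p _ ap] : a \in g @: setT by rewrite gB !inE eqxx.
have /imsetP[q _ bq] : b \in g @: setT by rewrite gB !inE eqxx orbT.
have npq : p != q by apply: contraNneq ab => pq; rewrite ap pq -bq.
have gS : g @: setT :\ g p :\ g q = S.
  by rewrite gB -ap -bq setU1K ?setU1K // !inE negb_or ab aS.
have E x y : (minor A (upd2 g p q x y) != 0) = (x |: (y |: S) \in bases M).
  by rewrite minorE imset_upd2 // gS.
by apply/andP; rewrite -!E; apply: (crossing_minor Apos npq cr); rewrite E.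
Qed.

(** * Bases of maximal weight *)

Variables (w : 'I_n -> R) (b : R).
Hypothesis w_le : forall B, B \in bases M -> \sum_(i in B) w i <= b.

Let Bs := [set B in bases M | \sum_(i in B) w i == b].

Lemma max_weight_pair A B : A \in bases M -> B \in bases M ->
  \sum_(i in A) w i + \sum_(i in B) w i = b + b -> (A \in Bs) && (B \in Bs).
Proof.
move=> AM BM E; rewrite !inE AM BM /=.
by have := w_le AM; have := w_le BM => lA lB; apply/andP; split; apply/eqP; lra.
Qed.

(** A symmetric exchange keeps the total weight of the two bases, so both results are again
    maximal. *)
Lemma max_weight_exchange : basis_exchange Bs.
Proof.
move=> A B; rewrite !inE => /andP[AM /eqP wA] /andP[BM /eqP wB] x xAB.
have [y yBA /andP[A'M B'M]] := positroid_symmetric_exchange AM BM xAB.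
exists y => //; have /andP[] // : (y |: A :\ x \in Bs) && (x |: B :\ y \in Bs).
apply: max_weight_pair => //; move: xAB yBA; rewrite !inE => /andP[xB xA] /andP[yA yB].
rewrite !sum_exchange // wA wB; ring.
Qed.

(** The two bases produced together use the same elements, with multiplicity, as the first two given
    ones, so [max_weight_pair] applies. *)
Lemma max_weight_crossing : crossing_exchange Bs.
Proof.
have sum2 (x y : 'I_n) (S : {set 'I_n}) : x != y -> x \notin S -> y \notin S ->
    \sum_(i in x |: (y |: S)) w i = w x + (w y + \sum_(i in S) w i).
  by move=> xy xS yS; rewrite !big_setU1 // !inE negb_or xy.
move=> a c b' e S cr /[dup] un; rewrite /= !inE !negb_or.
move=> /and4P[/and3P[ac ab ae] /andP[cb ce] be _] /[dup] nS /and4P[aS cS bS eS].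
case/and4P => /andP[m1 /eqP w1] /andP[m2 /eqP w2] /andP[m3 /eqP w3] /andP[m4 /eqP w4].
have /andP[m5 m6] := positroid_crossing_exchange cr un nS (introT and4P (And4 m1 m2 m3 m4)).
have := max_weight_pair m5 m6; rewrite !inE; apply.
move: w1 w2 w3 w4; rewrite !sum2 // 1?eq_sym //.
set s := \sum_(i in S) w i; lra.
Qed.

End Positroid.

(** * Weighted noncrossing partitions *)

Section NCPartitions.
Variables n d : nat.
Implicit Types (sigma tau : NC n d) (A B C D : {set 'I_n}) (P Q : {set {set 'I_n}}).

(* The weights along a chain of partitions are all cut out by one set [D]: any
   basis of the smallest face. *)
Definition weighted_by D sigma :=
  forall C, C \in blocks sigma -> weight sigma C = #|D :&: C|.

Lemma NC_partition sigma : finset.partition (blocks sigma) [set: 'I_n].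
Proof. by rewrite /blocks; case: sigma => -[P w] /= /and5P[]. Qed.

Lemma NC_noncrossing sigma : noncrossing (blocks sigma).
Proof. by rewrite /blocks; case: sigma => -[P w] /= /and5P[]. Qed.

Lemma card_partition_setI D P : finset.partition P [set: 'I_n] ->
  (\sum_(C in P) #|D :&: C|)%N = #|D|.
Proof.
have cE A : #|D :&: A| = (\sum_(i in A) (i \in D))%N.
  by rewrite -sum1_card big_mkcond [RHS]big_mkcond; apply: eq_bigr => i _ /=;
    rewrite inE; case: (i \in D); case: (i \in A).
move=> partP; rewrite (eq_bigr _ (fun C _ => cE C)) -(set_partition_big _ partP).
by rewrite -cE setIT.
Qed.

Lemma exists_NC D P : finset.partition P [set: 'I_n] -> noncrossing P -> #|D| = d ->
  exists2 sigma, blocks sigma = P & weighted_by D sigma.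
Proof.
move=> partP ncP cardD.
(* [inord] does not truncate because the cardinal is at most [n]; the value off the blocks is the
   one required by [weighted_ncp]. *)
pose w := [ffun C : {set 'I_n} => if C \in P then inord #|D :&: C| else ord0 : 'I_n.+1].
have wE C : C \in P -> w C = #|D :&: C| :> nat.
  by move=> CP; rewrite ffunE CP inordK // ltnS -[X in (_ <= X)%N]card_ord max_card.
have wP : weighted_ncp d (P, w).
  apply/and5P; split=> //.
  - by apply/'forall_implyP => C CP; rewrite wE // subset_leq_card // subsetIr.
  - by apply/forallP => C; apply/implyP => /negPf CP; rewrite ffunE CP.
  - by rewrite (eq_bigr _ wE) card_partition_setI // cardD.
by exists (exist _ (P, w) wP) => // C /wE.
Qed.

Lemma weighted_by_inj D sigma tau : weighted_by D sigma -> weighted_by D tau ->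
  blocks sigma = blocks tau -> sigma = tau.
Proof.
case: sigma => -[P v] /= Pv; case: tau => -[Q w] /= Qw.
rewrite /weighted_by /weight /blocks /= => wv ww PQ; rewrite PQ in wv Pv *.
apply/val_inj => /=; congr (_, _); apply/ffunP => C; apply/val_inj => /=.
have [CP|CP] := boolP (C \in Q); first by rewrite wv // ww.
case/and5P: Pv => _ _ _ /forallP/(_ C)/implyP/(_ CP)/eqP -> _.
by case/and5P: Qw => _ _ _ /forallP/(_ C)/implyP/(_ CP)/eqP -> _.
Qed.

Lemma block_eq P C B x : finset.partition P [set: 'I_n] -> C \in P -> B \in P ->
  x \in C -> x \in B -> C = B.
Proof.
by case/and3P=> _ tI _ CP BP xC xB; rewrite -(def_pblock tI CP xC) (def_pblock tI BP xB).
Qed.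

Lemma block_ex P x : finset.partition P [set: 'I_n] -> exists2 C, C \in P & x \in C.
Proof.
case/and3P=> /eqP cov _ _; have xc : x \in cover P by rewrite cov inE.
by exists (pblock P x); rewrite ?pblock_mem ?mem_pblock.
Qed.

Lemma noncrossingP P : reflect
  (forall B C, B \in P -> C \in P -> B != C -> forall a c b e,
     a \in B -> c \in B -> b \in C -> e \in C -> ~~ cyclically_ordered a b c e)
  (noncrossing P).
Proof.
apply: (iffP idP) => [/'forall_implyP H B C BP CP BC a c b e aB cB bC eC|H].
  by move: (H _ BP) => /'forall_implyP/(_ _ CP)/implyP/(_ BC)/'forall_implyP/(_ _ aB)
    /'forall_implyP/(_ _ cB)/'forall_implyP/(_ _ bC)/'forall_implyP/(_ _ eC).
apply/'forall_implyP => B BP; apply/'forall_implyP => C CP; apply/implyP => BC.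
apply/'forall_implyP => a aB; apply/'forall_implyP => c cB.
by apply/'forall_implyP => b bC; apply/'forall_implyP => e eC; apply: (H B C).
Qed.

(* The witness is the block inside [B] with the largest minimum. *)
Lemma interval_block P B m0 : finset.partition P [set: 'I_n] -> noncrossing P ->
  (forall C x y, C \in P -> x \in C -> y \in C -> x \in B -> y \in B) -> m0 \in B ->
  exists A, [/\ A \in P, A \subset B & forall a c x, a \in A -> c \in A -> x \in B ->
    (a < x)%N -> (x < c)%N -> x \in A].
Proof.
move=> partP /noncrossingP nc refB m0B.
(* Elements of [B] that are minimal in their own block. *)
pose ismin m := (m \in B) && [forall C in P, (m \in C) ==> [forall y in C, m <= y]%N].
have exmin C x : C \in P -> x \in C -> x \in B ->
    exists m, [/\ m \in C, ismin m & forall y, y \in C -> (m <= y)%N].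
  move=> CP xC xB; case: (@arg_minnP _ x [in C] val xC) => m mC mmin; exists m; split=> //.
  rewrite /ismin (refB C x m) //=; apply/'forall_implyP => C' C'P; apply/implyP => mC'.
  by rewrite (block_eq partP C'P CP mC' mC); apply/'forall_implyP => y /mmin.
have [C0 C0P m0C0] := block_ex m0 partP.
have [m1 [_ m1min _]] := exmin _ _ C0P m0C0 m0B.
case: (@arg_maxnP _ m1 ismin val m1min) => m mmin mmax.
have [A AP mA] := block_ex m partP; case/andP: (mmin) => mB.
move=> /'forall_implyP/(_ _ AP)/implyP/(_ mA)/'forall_implyP mle.
exists A; split=> // [|a c x aA cA xB ax xc].
  by apply/subsetP => y yA; apply: (refB A m).
have [C CP xC] := block_ex x partP.
have [m' [m'C m'min m'le]] := exmin _ _ CP xC xB.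
have [->//|nCA] := eqVneq A C.
have nm : m' != m.
  by apply: contraNneq nCA => e; rewrite e in m'C; rewrite (block_eq partP AP CP mA m'C).
have lm : (m' < m)%N by rewrite ltn_neqAle nm; apply: mmax.
(* The chain [m' < m < x < c] alternates between the blocks [C] and [A]. *)
have := nc C A CP AP _ m' x m c m'C xC mA cA; rewrite eq_sym => /(_ nCA)/negP[].
apply/or4P; apply: Or41; rewrite lm xc (leq_ltn_trans (mle _ aA) ax) //.
Qed.

(** Blocks coming from different old blocks inherit the property. A crossing of [A] with [B :\: A]
    would put an element of the latter between two elements of [A]. *)
Lemma split_noncrossing P A B : finset.partition P [set: 'I_n] -> noncrossing P ->
  B \in P -> A \subset B ->
  (forall a c x, a \in A -> c \in A -> x \in B -> (a < x)%N -> (x < c)%N -> x \in A) ->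
  noncrossing (A |: ((B :\: A) |: (P :\ B))).
Proof.
move=> partP /noncrossingP nc BP sAB int; apply/noncrossingP => X Y XP YP XY.
have sub Z : Z \in A |: ((B :\: A) |: (P :\ B)) ->
    exists Z', [/\ Z' \in P, Z \subset Z' & Z' != B -> Z = Z'].
  rewrite !inE => /or3P[/eqP->|/eqP->|/andP[_ ZP]]; last by exists Z.
    by exists B; split=> // /eqP.
  by exists B; split=> [//||/eqP//]; exact: subsetDl.
have [X' [X'P sX eX]] := sub X XP; have [Y' [Y'P sY eY]] := sub Y YP.
move=> a c b e aX cX bY eY'.
have [e'|nXY] := eqVneq X' Y'; last first.
  by apply: (nc X' Y') => //; do [exact: (subsetP sX) | exact: (subsetP sY)].
subst Y'; have [eB|nB] := eqVneq X' B; last by case/eqP: XY; rewrite eX // eY.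
subst X'.
have inB Z z : Z \in A |: ((B :\: A) |: (P :\ B)) -> Z \subset B -> z \in Z -> Z = A \/ Z = B :\: A.
  rewrite !inE => /or3P[/eqP->|/eqP->|/andP[nZ ZP]] sZ zZ; [by left|by right|].
  by case/eqP: nZ; apply: (block_eq partP ZP BP zZ (subsetP sZ _ zZ)).
have [XA|XD] := inB X a XP sX aX; have [YA|YD] := inB Y b YP sY bY.
- by rewrite XA YA eqxx in XY.
- subst X Y; move: bY eY'; rewrite !inE => /andP[/negP bA bB] /andP[/negP eA eB].
  apply/negP => /or4P[]/and3P[l1 l2 l3].
  + by apply: bA; apply: (int a c).
  + by apply: eA; apply: (int c a).
  + by apply: eA; apply: (int c a).
  + by apply: bA; apply: (int a c).
- subst X Y; move: aX cX; rewrite !inE => /andP[/negP aA aB] /andP[/negP cA cB].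
  apply/negP => /or4P[]/and3P[l1 l2 l3].
  + by apply: cA; apply: (int b e).
  + by apply: cA; apply: (int b e).
  + by apply: aA; apply: (int e b).
  + by apply: aA; apply: (int e b).
- by rewrite XD YD eqxx in XY.
Qed.

Lemma split_partition P A B : finset.partition P [set: 'I_n] -> B \in P ->
  A \proper B -> A != set0 -> finset.partition (A |: ((B :\: A) |: (P :\ B))) [set: 'I_n].
Proof.
move=> partP BP /andP[sAB nBA] nA.
have dB : B :\: A != set0 by rewrite setD_eq0.
have /and3P[/eqP cov tI n0] := partP.
have cl (X Y : {set 'I_n}) : X \in P :\ B -> Y \subset B -> [disjoint Y & X].
  rewrite !inE => /andP[nXB XP] sY; rewrite -setI_eq0; apply/eqP/setP => z.
  rewrite !inE; apply/andP => -[/(subsetP sY) zB zX].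
  by case/eqP: nXB; apply: (block_eq partP XP BP zX zB).
apply/and3P; split.
- rewrite eqEsubset subsetT; apply/subsetP => z _.
  have [C CP zC] := block_ex z partP; apply/bigcupP.
  have [CB|nCB] := eqVneq C B; last by exists C => //; rewrite !inE nCB CP !orbT.
  have [zA|zA] := boolP (z \in A); first by exists A; rewrite // !inE eqxx.
  by exists (B :\: A); rewrite ?inE ?eqxx ?orbT // zA -CB.
- apply/trivIsetP => X Y; rewrite !(in_setU1 _ _ (_ :|: _)) !(in_setU1 _ _ (P :\ B)).
  have dAD : [disjoint A & B :\: A] by rewrite -setI_eq0 setIDA setDIl setDv set0I.
  case/or3P => [/eqP->|/eqP->|XP] /or3P[/eqP->|/eqP->|YP]; rewrite ?eqxx // => nXY.
  + exact: cl.
  + by rewrite disjoint_sym.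
  + by apply: cl => //; exact: subsetDl.
  + by rewrite disjoint_sym; apply: cl.
  + by rewrite disjoint_sym; apply: cl => //; exact: subsetDl.
  + by move: XP YP; rewrite !inE => /andP[_ XP] /andP[_ YP]; apply: (trivIsetP tI).
- by rewrite !inE !negb_or eq_sym nA eq_sym dB (negPf n0) andbF.
Qed.

(** Induction on the number of blocks of [sigma] that are not blocks of [tau]. Splitting an interval
    block [A] of [sigma] off a block [B] of [tau] gives [tau'], covered by [tau] and still coarser
    than [sigma]. *)
Lemma NC_le_refine D sigma tau : #|D| = d ->
  weighted_by D sigma -> weighted_by D tau ->
  (forall C, C \in blocks sigma -> exists2 B, B \in blocks tau & C \subset B) ->
  NC_le sigma tau.
Proof.
move=> cardD ws; have [k] := ubnP #|blocks sigma :\: blocks tau|.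
elim: k tau => // k IH tau ltk wt ref.
have partS := NC_partition sigma; have partT := NC_partition tau.
have refB B C x y : B \in blocks tau -> C \in blocks sigma -> x \in C -> y \in C ->
    x \in B -> y \in B.
  move=> BT CS xC yC xB; have [B' B'T sCB] := ref C CS.
  by rewrite (block_eq partT BT B'T xB (subsetP sCB _ xC)) (subsetP sCB).
have n0S C : C \in blocks sigma -> exists x, x \in C.
  move=> CS; have /and3P[_ _ n0] := partS; apply/set0Pn.
  by apply: contraNneq n0 => <-.
have [sST|/subsetPn[C0 C0S C0T]] := boolP (blocks sigma \subset blocks tau).
  suff -> : sigma = tau by exact: connect0.
  apply: (weighted_by_inj ws wt); apply/eqP; rewrite eqEsubset sST.
  apply/subsetP => B BT; have /and3P[_ _ n0] := partT.
  have /set0Pn[x xB] : B != set0 by apply: contraNneq n0 => <-.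
  have [C CS xC] := block_ex x partS.
  by rewrite (block_eq partT BT (subsetP sST _ CS) xB xC).
have [B BT sCB] := ref _ C0S; have [m0 m0C] := n0S _ C0S.
have [A [AS sAB int]] := interval_block partS (NC_noncrossing sigma) (fun C x y => @refB B C x y BT)
  (subsetP sCB _ m0C).
have [a aA] := n0S _ AS.
have nBS : B \notin blocks sigma.
  apply: contra C0T => BS.
  by rewrite (block_eq partS C0S BS m0C (subsetP sCB _ m0C)).
have nAT : A \notin blocks tau.
  by apply: contra nBS => AT; rewrite -(block_eq partT AT BT aA (subsetP sAB _ aA)).
have pAB : A \proper B.
  by rewrite properEneq sAB andbT; apply: contraNneq nBS => <-.
have nA0 : A != set0 by apply/set0Pn; exists a.
have [tau' bT' wT'] := exists_NC (split_partition partT BT pAB nA0)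
  (split_noncrossing partT (NC_noncrossing tau) BT sAB int) cardD.
apply: (connect_trans (y := tau')).
  apply: IH => // [|C CS].
    (* Only [B] stops being a block, and it is not a block of [sigma], whereas [A] becomes a common
       block. *)
    apply: leq_trans (ltk : (_ <= k)%N); apply: proper_card; rewrite bT'; apply/properP; split.
      apply/subsetP => C; rewrite !in_setD !in_setU1 in_setD1 => /andP[nC CS].
      rewrite CS andbT; apply: contra nC => CT; rewrite CT andbT.
      by have -> : C != B; rewrite ?orbT //; apply: contraNneq nBS => <-.
    by exists A; rewrite !in_setD ?AS ?nAT // in_setU1 eqxx.
  have [CA|nCA] := eqVneq C A; first by exists A; rewrite ?CA // bT' in_setU1 eqxx.
  have [B' B'T sCB'] := ref _ CS; have [B'B|nB'] := eqVneq B' B.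
    exists (B :\: A); first by rewrite bT' in_setU1 in_setU1 eqxx orbT.
    rewrite -B'B subsetD sCB' -setI_eq0 /=; apply/set0Pn => -[x].
    by rewrite inE => /andP[xC xA]; case/eqP: nCA; apply: (block_eq partS CS AS xC xA).
  by exists B' => //; rewrite bT' !in_setU1 in_setD1 nB' B'T !orbT.
apply: connect1; apply/existsP; exists B; rewrite BT /=; apply/existsP; exists A.
rewrite nA0 pAB bT' eqxx /=; apply/andP; split.
  rewrite wt // !wT' ?bT' ?in_setU1 ?eqxx ?orbT //.
  by rewrite -(cardsID A (D :&: B)) -setIA (setIidPr sAB) setIDA.
apply/'forall_implyP => C; rewrite in_setD1 => /andP[nCB CT].
by rewrite wt // wT' // bT' !in_setU1 in_setD1 nCB CT !orbT.
Qed.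

End NCPartitions.

(** * Faces of the matroid polytope *)

Section BlockSums.
Variables (R : realType) (n d : nat).
Implicit Types (sigma tau : NC n d) (x : 'rV[R]_n).

Definition block_sums x sigma : Prop :=
  forall C : {set 'I_n}, C \in blocks sigma -> \sum_(i in C) x 0 i = (weight sigma C)%:R.

(** The equation of the merged block is the sum of those of its two pieces. *)
Lemma NC_cover_block_sums x sigma tau :
  NC_cover sigma tau -> block_sums x sigma -> block_sums x tau.
Proof.
case/existsP => B /andP[BT /existsP[A /and4P[/andP[_ /proper_sub sAB] /eqP bS /eqP wB]]].
move=> /'forall_implyP wC sx C CT; have [->|nCB] := eqVneq C B; last first.
  have CB : C \in blocks tau :\ B by rewrite in_setD1 nCB.
  by rewrite (eqP (wC C CB)) sx // bS !in_setU1 CB !orbT.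
by rewrite wB natrD -!sx ?bS ?in_setU1 ?eqxx ?orbT // (big_setID A) /= (setIidPr sAB).
Qed.

Lemma NC_le_block_sums x sigma tau :
  NC_le sigma tau -> block_sums x sigma -> block_sums x tau.
Proof.
case/connectP => s sP ->; elim: s sigma sP => //= rho s IH sigma /andP[c sP] sx.
by apply: IH => //; apply: NC_cover_block_sums sx.
Qed.

End BlockSums.

From mathcomp Require Import all_classical all_reals.

Local Open Scope classical_set_scope.
Local Open Scope ring_scope.

(** * Maximizing bases and the functional defining a face *)

Section Faces.
Variables (R : realType) (n : nat) (M : matroid 'I_n).
Implicit Types (c x y : 'rV[R]_n) (b : R) (B C : {set 'I_n}).

Lemma indicator_vectorE B i : indicator_vector R B 0 i = (i \in B)%:R.
Proof.
rewrite /indicator_vector summxE (eq_bigr (fun j => (i == j)%:R)); last first.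
  by move=> j _; rewrite mxE eqxx.
have [iB|iB] := boolP (i \in B).
  rewrite (bigD1 i) //= eqxx big1 ?addr0 // => j /andP[_ nji].
  by rewrite eq_sym (negPf nji).
by rewrite big1 // => j jB; case: eqVneq => // ij; rewrite ij jB in iB.
Qed.

Lemma sum_indicator_vector B C :
  \sum_(i in C) indicator_vector R B 0 i = #|B :&: C|%:R.
Proof.
rewrite -sum1_card natr_sum big_mkcond [RHS]big_mkcond; apply: eq_bigr => i _.
by rewrite indicator_vectorE inE; case: (i \in B); case: (i \in C).
Qed.

Lemma dot_indicator_vector c B : dot c (indicator_vector R B) = \sum_(i in B) c 0 i.
Proof.
rewrite /dot [RHS]big_mkcond; apply: eq_bigr => i _.
by rewrite indicator_vectorE; case: (i \in B); rewrite ?mulr1 ?mulr0.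
Qed.

Lemma indicator_vector_polytope B : B \in bases M ->
  matroid_polytope R M (indicator_vector R B).
Proof.
move=> BM; exists 1%N, (fun=> indicator_vector R B), (fun=> 1); split=> //.
- by move=> _; exists B.
- by rewrite big_ord1.
- by rewrite big_ord1 scale1r.
Qed.

Lemma matroid_polytope_convex x : matroid_polytope R M x ->
  exists k (B : 'I_k -> {set 'I_n}) (t : 'I_k -> R),
  [/\ forall j, B j \in bases M, forall j, 0 <= t j, \sum_j t j = 1
    & x = \sum_j t j *: indicator_vector R (B j)].
Proof.
case=> k [p [t [Sp t0 t1 ->]]].
have /choice[B HB] : forall j, exists B : {set 'I_n},
    B \in bases M /\ indicator_vector R B = p j.
  by move=> j; case: (Sp j) => B BM <-; exists B.
exists k, B, t; split=> // [j|]; first by case: (HB j).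
by apply: eq_bigr => j _; case: (HB j) => _ ->.
Qed.

Lemma dot_sum c k (t : 'I_k -> R) (p : 'I_k -> 'rV[R]_n) :
  dot c (\sum_j t j *: p j) = \sum_j t j * dot c (p j).
Proof.
rewrite /dot; under eq_bigr do rewrite summxE mulr_sumr.
rewrite exchange_big; apply: eq_bigr => j _; rewrite mulr_sumr.
by apply: eq_bigr => i _; rewrite mxE mulrCA.
Qed.

Definition face_bases c b : {set {set 'I_n}} :=
  [set B in bases M | \sum_(i in B) c 0 i == b]%SET.

(** In a convex combination attaining the maximum, the weighted gaps to [b] are nonnegative and sum
    to zero, so each vanishes. *)
Lemma face_convex c b x : (forall y, matroid_polytope R M y -> dot c y <= b) ->
  matroid_polytope R M x -> dot c x = b ->
  exists k (B : 'I_k -> {set 'I_n}) (t : 'I_k -> R),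
  [/\ forall j, t j != 0 -> B j \in face_bases c b, \sum_j t j = 1
    & x = \sum_j t j *: indicator_vector R (B j)].
Proof.
move=> cb /matroid_polytope_convex[k [B [t [BM t0 t1 xE]]]] cx.
exists k, B, t; split=> // j tj; rewrite inE BM /=.
have le0 i : true -> 0 <= t i * (b - \sum_(l in B i) c 0 l).
  move=> _; rewrite mulr_ge0 // subr_ge0 -dot_indicator_vector; apply: cb.
  exact: indicator_vector_polytope.
have /psumr_eq0P : \sum_i t i * (b - \sum_(l in B i) c 0 l) = 0.
  under eq_bigr do rewrite mulrBr.
  rewrite sumrB -mulr_suml t1 mul1r -{1}cx xE dot_sum.
  by under eq_bigr do rewrite dot_indicator_vector; rewrite subrr.
move=> /(_ le0 j isT)/eqP; rewrite mulf_eq0 (negPf tj) subr_eq0 eq_sym; exact.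
Qed.

Lemma face_bases_max c b : (forall y, matroid_polytope R M y -> dot c y <= b) ->
  forall B, B \in bases M -> \sum_(i in B) c 0 i <= b.
Proof.
by move=> cb B BM; rewrite -dot_indicator_vector; apply/cb/indicator_vector_polytope.
Qed.

(** The two bases of the exchange have the same weight [b] and differ only by [i] and [j]. *)
Lemma exchangeable_coeff c b i j :
  exchangeable (face_bases c b) i j -> c 0 i = c 0 j.
Proof.
case/existsP => B /and4P[]; rewrite !inE => /andP[_ /eqP wB] iB jB /andP[_ /eqP].
by rewrite sum_exchange // wB => /eqP; rewrite -subr_eq0 => /eqP; lra.
Qed.

Lemma component_coeff c b C i j : C \in components (face_bases c b) ->
  i \in C -> j \in C -> c 0 i = c 0 j.
Proof.
move=> CP iC; rewrite (mem_component _ CP iC).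
by apply: (@connect_invariant _ _ _ (fun i => c 0 i)) => u v _; exact: exchangeable_coeff.
Qed.

Lemma dot_components c b x y :
  (forall C, C \in components (face_bases c b) ->
     \sum_(i in C) x 0 i = \sum_(i in C) y 0 i) ->
  dot c x = dot c y.
Proof.
move=> xy; apply/eqP; rewrite -subr_eq0 -sumrB; apply/eqP.
under eq_bigr do rewrite -mulrBr.
rewrite (eq_bigl (fun i => i \in [set: 'I_n]%SET)); last by move=> i; rewrite finset.in_setT.
rewrite (set_partition_big _ (components_partition (face_bases c b))) /=.
apply: big1 => C CP; have [->|[i iC]] := finset.set_0Vmem C; first by rewrite big_set0.
rewrite (eq_bigr (fun j => c 0 i * (x 0 j - y 0 j))); last first.
  by move=> j jC; rewrite (component_coeff CP iC jC).
by rewrite -mulr_sumr sumrB xy // subrr mulr0.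
Qed.

End Faces.

(** * From faces to weighted noncrossing partitions *)

Section Main.
Variables (R : realType) (n d : nat) (M : matroid 'I_n).
Hypotheses (hM : positroid R M) (hd : matroid_rank M = d).
Local Notation P := (matroid_polytope R M).

(** A relation, since a face does not determine its functional. The weights are tied to every basis
    of the face, so that a basis of a smaller face can serve for both. *)
Definition represents (F : set 'rV[R]_n) (sigma : NC n d) : Prop :=
  F !=set0 /\ exists c b, [/\ forall x, P x -> dot c x <= b,
    F = [set x | P x /\ dot c x = b],
    blocks sigma = components (face_bases M c b)
  & forall B, B \in face_bases M c b -> weighted_by B sigma].

Lemma basis_card_rank B : B \in bases M -> #|B| = d.
Proof.
move=> BM; rewrite -hd /matroid_rank; apply/eqP; rewrite eqn_leq.
apply/andP; split; first exact: (leq_bigmax_cond (F := fun B : {set 'I_n} => #|B|) B).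
apply/bigmax_leqP => C CM.
by rewrite (basis_card (@matroid_basis_exchange _ M) CM BM).
Qed.

Lemma face_basis_ex c b x : (forall y, P y -> dot c y <= b) -> P x -> dot c x = b ->
  exists B, B \in face_bases M c b.
Proof.
move=> cb Px cx; have [k [B [t [BF t1 _]]]] := face_convex cb Px cx.
have /existsP[j tj] : [exists j, t j != 0].
  apply: contra_eqT t1 => /existsPn t0; rewrite big1 ?(eq_sym 0) ?oner_eq0 //.
  by move=> j _; apply/eqP/negPn/t0.
by exists (B j); apply: BF.
Qed.

Lemma represents_ex F : face P F -> F !=set0 -> exists sigma, represents F sigma.
Proof.
move=> [c [b [cb FE]]] F0; have [x Fx] := F0.
have [Px cx] : P x /\ dot c x = b by move: Fx; rewrite FE.
have [B BF] := face_basis_ex cb Px cx.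
have ex := max_weight_exchange hM (face_bases_max cb).
have cr := max_weight_crossing hM (face_bases_max cb).
have BM : B \in bases M by move: BF; rewrite inE => /andP[].
have [sigma bS wS] := exists_NC (components_partition (face_bases M c b))
  (components_noncrossing ex cr) (basis_card_rank BM).
exists sigma; split=> //; exists c, b; split=> // B' B'F C CS.
have CP : C \in components (face_bases M c b) by rewrite -bS.
by rewrite wS // (exchange_closed_card ex (component_closed CP) BF B'F).
Qed.

(** The equations hold at the indicator vectors of the bases of the face and pass to convex
    combinations. *)
Lemma represents_block_sums F sigma x : represents F sigma -> F x -> block_sums x sigma.
Proof.
move=> [_ [c [b [cb -> bS wS]]]] [Px cx] C CS.
have [k [B [t [BF t1 ->]]]] := face_convex cb Px cx.
under eq_bigr do rewrite summxE.
have -> : (weight sigma C)%:R = \sum_j t j * (weight sigma C)%:R.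
  by rewrite -mulr_suml t1 mul1r.
rewrite exchange_big /=; apply: eq_bigr => j _.
under eq_bigr do rewrite mxE.
rewrite -mulr_sumr; have [->|tj] := eqVneq (t j) 0; first by rewrite !mul0r.
by rewrite sum_indicator_vector (wS _ (BF j tj) C CS).
Qed.

Lemma represents_sub F G sigma tau : represents F sigma -> represents G tau ->
  F `<=` G <-> NC_le sigma tau.
Proof.
move=> rF rG; split=> [FG|le].
  have [[x Fx] [c [b [cb FE bS wS]]]] := rF.
  have [_ [c' [b' [cb' GE bT wT]]]] := rG.
  have sub : {subset face_bases M c b <= face_bases M c' b'}.
    move=> B; rewrite !inE => /andP[BM /eqP wB]; rewrite BM /=.
    have : F (indicator_vector R B).
      by rewrite FE; split; [exact: indicator_vector_polytope|rewrite dot_indicator_vector].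
    by move=> /FG; rewrite GE => -[_]; rewrite dot_indicator_vector => ->.
  move: Fx; rewrite FE => -[Px cx]; have [B BF] := face_basis_ex cb Px cx.
  have BM : B \in bases M by move: BF; rewrite inE => /andP[].
  (* The basis [B] belongs to both faces and cuts out the weights of both partitions. *)
  apply: (NC_le_refine (basis_card_rank BM) (wS _ BF) (wT _ (sub _ BF))).
  by rewrite bS bT => C; exact: components_refine.
move=> x Fx; have sx := NC_le_block_sums le (represents_block_sums rF Fx).
have Px : P x by have [_ [c [b [_ FE _ _]]]] := rF; move: Fx; rewrite FE => -[].
(* Any point [y] of [G] has the same block sums over [tau] as [x], hence the same value of the
   functional. *)
have [[y Gy] [c [b [cb GE bT wT]]]] := rG.
move: (Gy); rewrite GE => -[Py cy]; split=> //; rewrite -cy.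
apply: (@dot_components _ _ M c b) => C CP.
have CT : C \in blocks tau by rewrite bT.
by rewrite (sx C CT) (represents_block_sums rG Gy CT).
Qed.

End Main.

Theorem theorem9p3 (R : realType) (n d : nat) (M : matroid 'I_n)
    (hM : positroid R M) (hd : matroid_rank M = d) :
  exists phi : set 'rV[R]_n -> option (NC n d),
    (forall F G : set 'rV[R]_n,
       face (matroid_polytope R M) F -> face (matroid_polytope R M) G ->
       phi F = phi G -> F = G) /\
    (forall F G : set 'rV[R]_n,
       face (matroid_polytope R M) F -> face (matroid_polytope R M) G ->
       (F `<=` G <-> NC0_le (phi F) (phi G))).
Proof.
(* A representing partition is chosen; among faces only the empty one falls to [None]. *)
pose phi F := if pselect (exists sigma, @represents R n d M F sigma) is left h
  then Some (projT1 (cid h)) else None.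
exists phi.
have phiP F : face (matroid_polytope R M) F ->
    (F = set0 /\ phi F = None) \/ exists2 sigma, phi F = Some sigma & represents M F sigma.
  move=> fF; rewrite /phi; case: pselect => [h|nh].
    by right; exists (projT1 (cid h)) => //; exact: projT2 (cid h).
  left; split=> //; apply/eqP/negPn/negP => /set0P/(represents_ex hM hd fF); exact: nh.
have sub F G : face (matroid_polytope R M) F -> face (matroid_polytope R M) G ->
    (F `<=` G <-> NC0_le (phi F) (phi G)).
  move=> /phiP[[-> ->]|[sigma -> rF]]; first by split=> // _; exact: sub0set.
  move=> /phiP[[-> ->]|[tau -> rG]]; last exact: (represents_sub hd rF rG).
  by split=> // F0; case: rF => -[x /F0].
split=> // F G fF fG eFG.
have refl x : @NC0_le n d x x by case: x => //= sigma; exact: connect0.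
(* Injectivity follows from the order equivalence and the antisymmetry of inclusion. *)
by apply/seteqP; split; apply/sub => //; rewrite eFG refl.
Qed.
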